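(* Let $p$ be a prime and $m\geq 3$ an integer with $\gcd(p-1,m)=2$. Let $K=\mathbb{F}_{p^k}$ be a finite field containing the group $G$ of all $m$th roots of unity, and let $d=[\dot K:G]=(p^k-1)/m$, where $\dot K$ is the multiplicative group of $K$. Then every integer $n\geq d$ lies in $W_p(m)$, unless $p=3$ and $m=3^k-1$, in which case every integer $n\geq d+1$ lies in $W_3(m)$.
   Context: For a prime $p$ and a positive integer $m$, $W_p(m)$ denotes the set of integers $n\geq 0$ for which there exist $\alpha_1,\dots,\alpha_n\in\overline{\mathbb{F}}_p$ with $\alpha_i^m=1$ for all $i$ (repetitions allowed) and $\alpha_1+\cdots+\alpha_n=0$. *)

(* Defs.v *)
From HB Require Import structures.
From mathcomp Require Import all_boot all_fingroup all_algebra all_field.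
Set Implicit Arguments.
Unset Strict Implicit.
Unset Printing Implicit Defensive.

Import GroupScope GRing.Theory.

(* The set W_p(m), as a predicate on n, when L is an algebraic closure of F_p. *)
Definition vanishing_length (L : closedFieldType) (m n : nat) : Prop :=
  exists a : 'I_n -> L,
    (forall i, a i ^+ m = 1)%R /\ (\sum_(i < n) a i = 0)%R.

Definition roots_of_unity (K : finFieldType) (m : nat) : {set {unit K}} :=
  [set u : {unit K} | u ^+ m == 1].

Lemma roots_of_unity_group_set (K : finFieldType) (m : nat) :
  group_set (roots_of_unity K m).
Proof.
apply/group_setP; split=> [|u v]; first by rewrite inE expg1n.
have uvC : commute u v by apply: val_inj; rewrite /= mulrC.
by rewrite !inE expgMn // => /eqP-> /eqP->; rewrite mulg1.
Qed.

Canonical roots_of_unity_group (K : finFieldType) (m : nat) :=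
  group (roots_of_unity_group_set K m).

(* Main.v *)
(* Write [G] for the [m]-th roots of unity. Since [-1] is in [G], two roots
   cancel, so the set of lengths is determined by its least odd element, which is
   at most [p]. As [F_p^*] meets [G] only in [1] and [-1], the group [F_p^* G] has
   order [m (p - 1) / 2], so [(p - 1) / 2] divides [d]; hence either [d >= p - 1],
   where the length [p] suffices, or [d = (p - 1) / 2] and [K^* = F_p^* G].
   In the second case let [S n] be the set of elements of [F_p] that are sums of
   [n] elements of [G]; an odd length [n + 1] vanishes as soon as [1] is in [S n].
   Some [a] other than [0], [2], [-2] lies in [S 2], so by Cauchy-Davenport
   [#|S (2 r)| >= min (p, 4 r + 1)], which gives [S d = F_p] for even [d].
   For odd [d] one needs [S (d - 1) = F_p], two elements more. They come from an [a]
   in [S 2] other than [0], [2], [-2], [4], [-4]: then [1] is in [S 2], or [S 4]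
   has at least 11 elements. If no such [a] existed, all sums [g + h] of
   non-proportional elements of [G] would lie in [2 G] or [4 G], and the
   parallelogram identities between [g + h] and [g - h] refute this. *)
Require Import Defs.
From HB Require Import structures.
From mathcomp Require Import all_boot all_fingroup all_algebra all_field.
From mathcomp Require Import cyclic zify ring.

Set Implicit Arguments.
Unset Strict Implicit.
Unset Printing Implicit Defensive.

Import GRing.Theory.
Local Open Scope ring_scope.

Lemma exprN_even (R : pzRingType) (m : nat) (x : R) :
  ~~ odd m -> (- x) ^+ m = x ^+ m.
Proof. by move=> m_even; rewrite exprNn -signr_odd (negPf m_even) mul1r. Qed.

(** * The Cauchy-Davenport inequality in [F_p] *)

Section CauchyDavenport.

Variables (p : nat) (p_prime : prime p).
Implicit Types A B : {set 'F_p}.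

Definition sumset A B : {set 'F_p} := [set x + y | x in A, y in B].

(** A nonzero [t] generates the additive group of [F_p]. *)
Lemma shift_invariant_setT A (t : 'F_p) :
  A != set0 -> t != 0 -> {in A, forall a, a + t \in A} -> A = setT.
Proof.
move=> /set0Pn[a Aa] t0 At; apply/setP=> x; rewrite inE.
have An n : a + t *+ n \in A.
  by elim: n => [|n IH]; rewrite ?addr0 // mulrSr addrA At.
have -> : x = a + t *+ ((x - a) / t : 'F_p).
  by rewrite -[t *+ _]mulr_natr natr_Zp mulrC divfK // addrC subrK.
by rewrite An.
Qed.

(* Davenport's transform: after a translation of [B], the pair
   [(A :|: B, A :&: B)] has the same total size and no larger sumset. *)
Lemma cauchy_davenport A B : A != set0 -> B != set0 ->
  (minn p (#|A| + #|B|).-1 <= #|sumset A B|)%N.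
Proof.
have [n] := ubnP #|B|; elim: n => // n IH in A B *; rewrite ltnS => leBn A0 B0.
have transl (u : 'F_p) : #|[set b + u | b in B]| = #|B|.
  by apply: card_imset => x y /addIr.
have sum_transl u : #|sumset A [set b + u | b in B]| = #|sumset A B|.
  rewrite -[RHS](card_imset _ (@addIr _ u)); congr #|pred_of_set _|.
  apply/setP=> x; apply/imset2P/imsetP.
    move=> [a _ Aa /imsetP[b Bb ->] ->].
    by exists (a + b); rewrite ?addrA //; apply/imset2P; exists a b.
  move=> [_ /imset2P[a b Aa Bb ->] ->].
  by exists a (b + u); rewrite ?addrA //; apply/imsetP; exists b.
have [B1|B1] := eqVneq #|B| 1%N.
  have /cards1P[b ->] : #|B| == 1%N by apply/eqP.
  rewrite cards1 addn1 /= geq_min; apply/orP; right.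
  rewrite -(card_imset _ (@addIr _ b)) subset_leq_card //.
  by apply/subsetP=> _ /imsetP[a Aa ->]; apply/imset2P; exists a b; rewrite ?set11.
have /card_gt1P[b [b' [Bb Bb' bb']]] : (1 < #|B|)%N.
  by rewrite ltn_neqAle eq_sym B1 card_gt0.
have [/eqP ->|AnT] := boolP (A == setT).
  rewrite geq_min cardsT card_Fp //; apply/orP; left.
  rewrite -[leqLHS](card_Fp p_prime) -cardsT -(card_imset _ (@addIr _ b)).
  rewrite subset_leq_card //.
  by apply/subsetP=> _ /imsetP[a Aa ->]; apply/imset2P; exists a b.
(* Otherwise [A] is stable under the nonzero shift [b' - b], hence everything. Translating [B] so
   that [b] goes to [a] then puts [a] into [A :&: B'] and [a + (b' - b)] into [B'] outside [A]: the
   intersection is nonempty and smaller than [B']. *)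
have /exists_inP[a Aa nA] : [exists (a | a \in A), a + (b' - b) \notin A].
  apply: contraNT AnT => /exists_inPn AA; apply/eqP.
  apply: (@shift_invariant_setT _ (b' - b)) => //; last first.
    by move=> a /AA; rewrite negbK.
  by rewrite subr_eq0 eq_sym.
pose B' := [set x + (a - b) | x in B].
have B'a : a \in B' by apply/imsetP; exists b => //; rewrite addrC subrK.
have I0 : A :&: B' != set0 by apply/set0Pn; exists a; rewrite inE Aa.
have U0 : A :|: B' != set0 by apply/set0Pn; exists a; rewrite inE Aa.
have ltI : (#|A :&: B'| < #|B'|)%N.
  apply: proper_card; rewrite properE subsetIr /=.
  apply/subsetPn; exists (a + (b' - b)).
    by apply/imsetP; exists b' => //; rewrite addrCA.
  by rewrite inE (negPf nA).
have := IH (A :|: B') (A :&: B').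
rewrite -(transl (a - b)) -/B' in leBn *.
rewrite cardsUI => /(_ (leq_trans ltI leBn) U0 I0) /leq_trans-> //.
rewrite -(sum_transl (a - b)) -/B' subset_leq_card //.
apply/subsetP=> _ /imset2P[x y /setUP[] Hx /setIP[Ay By] ->].
  by apply/imset2P; exists x y.
by apply/imset2P; exists y x; rewrite // addrC.
Qed.

End CauchyDavenport.

(** * Counting in sets closed under negation *)

Section SymmetricSets.

Variable F : finFieldType.

(** The entries of [s] are distinct up to sign, and [x != - x] because [2] is nonzero; so [0], [s]
    and [- s] do not overlap. *)
Lemma card_symmetric (A : {set F}) (s : seq F) :
    2%:R != 0 :> F -> 0 \in A -> {in A, forall x, - x \in A} ->
    {subset s <= A} -> 0 \notin s ->
    pairwise (fun x y => (x != y) && (x != - y)) s ->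
  ((size s).*2.+1 <= #|A|)%N.
Proof.
move=> two A0 AN sA s0 ps.
have us : uniq s by rewrite uniq_pairwise; apply: sub_pairwise ps => x y /andP[].
have sN x : x \in s -> - x \notin s.
  move=> sx; apply/negP=> sNx.
  elim: s ps sx sNx s0 {sA us} => //= y s IH /andP[/allP ay ps].
  rewrite !inE negb_or => /orP[/eqP xy|sx] /orP[/eqP Nxy|sNx] /andP[y0 s0].
  - move: y0; rewrite -{1}Nxy xy eq_sym oppr_eq0 => y0.
    have /eqP : y *+ 2 = 0 by rewrite mulr2n -{1}Nxy xy addNr.
    by rewrite -mulr_natr mulf_eq0 (negPf y0) (negPf two).
  - by have := ay _ sNx; rewrite xy opprK eqxx andbF.
  - by have := ay _ sx; rewrite -Nxy eqxx andbF.
  - exact: IH.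
pose l := 0 :: s ++ map -%R s.
have ul : uniq l.
  rewrite /= cat_uniq us (map_inj_uniq oppr_inj) us mem_cat negb_or s0 /= andbT.
  apply/andP; split.
    apply/mapP=> -[x sx /eqP]; rewrite eq_sym oppr_eq0 => /eqP x0.
    by rewrite -x0 sx in s0.
  by apply/hasPn=> _ /mapP[x sx ->]; apply: sN.
have -> : (size s).*2.+1 = size l by rewrite /= size_cat size_map addnn.
rewrite -(card_uniqP ul) subset_leq_card //; apply/subsetP=> x.
rewrite inE mem_cat => /or3P[/eqP->//|/sA//|/mapP[y /sA Ay ->]]; exact: AN.
Qed.

(* The classes [2, 4, a, 2a] up to sign are distinct, and [a + 2] is a fifth one
   unless [a = - 6] or [a = - 2 / 3]. *)
Lemma pairwise_five (a : F) :
    2%:R != 0 :> F -> 3%:R != 0 :> F ->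
    [&& a != 0, a != 1, a != -1, a != 2%:R, a != - 2%:R, a != 4%:R & a != - 4%:R] ->
    a != - 6%:R -> 3%:R * a != - 2%:R ->
  let s := [:: 2%:R; 4%:R; a; 2%:R * a; a + 2%:R] in
  (0 \notin s) && pairwise (fun x y => (x != y) && (x != - y)) s.
Proof.
move=> two three /and5P[a0 a1 aN1 a2 /and3P[aN2 a4 aN4]] aN6 a3 /=.
(* Most inequalities below factor a difference into two nonzero elements [k] and [z]. *)
have P (x y : F) k z : k != 0 -> z != 0 -> x - y = k * z -> x != y.
  by move=> k0 z0 E; rewrite -subr_eq0 E mulf_neq0.
have N1 : (1 : F) != 0 by exact: oner_neq0.
have D (x y : F) : x != y -> x - y != 0 by rewrite subr_eq0.
have D' (x y : F) : x != - y -> x + y != 0 by rewrite addr_eq0.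
have four : 4%:R != 0 :> F by rewrite (natrM _ 2 2) mulf_neq0.
rewrite !inE !negb_or !andbT.
apply/andP; split.
  rewrite !(eq_sym 0) two four a0 mulf_neq0 //=; exact: D'.
have S (x y : F) k z : k != 0 -> z != 0 -> y - x = k * z -> x != y.
  by move=> k0 z0 E; rewrite eq_sym (P _ _ k z).
apply/and4P; split.
- apply/and4P; split; apply/andP; split.
  + by apply: (S _ _ 2%:R 1) => //; ring.
  + by apply: (P _ _ 2%:R 3%:R) => //; ring.
  + by rewrite eq_sym.
  + by rewrite -eqr_oppLR eq_sym.
  + by apply: (S _ _ 2%:R (a - 1)) => //; [exact: D | ring].
  + by apply: (P _ _ 2%:R (a + 1)) => //; [exact: D' | ring].
  + by apply: (S _ _ 1 a) => //; ring.
  + by apply: (P _ _ 1 (a + 4%:R)) => //; [exact: D' | ring].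
- apply/and3P; split; apply/andP; split.
  + by rewrite eq_sym.
  + by rewrite -eqr_oppLR eq_sym.
  + by apply: (S _ _ 2%:R (a - 2%:R)) => //; [exact: D | ring].
  + by apply: (P _ _ 2%:R (a + 2%:R)) => //; [exact: D' | ring].
  + by apply: (S _ _ 1 (a - 2%:R)) => //; [exact: D | ring].
  + by apply: (P _ _ 1 (a + 6%:R)) => //; [exact: D' | ring].
- apply/andP; split; apply/andP; split.
  + by apply: (S _ _ 1 a) => //; ring.
  + by apply: (P _ _ 3%:R a) => //; ring.
  + by apply: (S _ _ 1 2%:R) => //; ring.
  + by apply: (P _ _ 2%:R (a + 1)) => //; [exact: D' | ring].
- apply/andP; split.
  + by apply: (P _ _ 1 (a - 2%:R)) => //; [exact: D | ring].
  + by apply: (P _ _ 1 (3%:R * a + 2%:R)) => //; [exact: D' | ring].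
Qed.

End SymmetricSets.

(** * Cosets of [G] that contain sums of two roots *)

Section SumsOfTwoRoots.

Variables (K : fieldType) (m : nat).
Hypotheses (m_even : ~~ odd m) (two : 2%:R != 0 :> K).
Hypothesis three_m : 3%:R ^+ m != 1 :> K.

(** Cosets of [G] are told apart by [m]-th powers: as [2] is nonzero, [u] lies in [2 G] exactly when
    [u ^+ m = t], and in [4 G] exactly when [u ^+ m = t ^+ 2]. *)
Local Notation t := (2%:R ^+ m : K).
Hypothesis t1 : t != 1.

Local Notation G x := (x ^+ m = 1 :> K).
Local Notation gen x y := (x != y /\ x != - y).

Let expN x : (- x) ^+ m = x ^+ m :> K.
Proof. exact: exprN_even. Qed.

Let GN x : G x -> G (- x).
Proof. by rewrite expN. Qed.

Let t0 : t != 0. Proof. exact: expf_neq0. Qed.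

Let mul_t u : t * u = t -> u = 1.
Proof. by move=> E; apply: (mulfI t0); rewrite E mulr1. Qed.

Let G3 x y : G x -> G y -> 3%:R * x = y -> False.
Proof.
by move=> Gx Gy E; move/eqP: three_m; apply; rewrite -[RHS]Gy -E exprMn Gx mulr1.
Qed.

Let G0 x : G x -> x != 0.
Proof.
move=> Gx; apply: contra_neq three_m => x0.
move: Gx; rewrite x0 expr0n; case: (m) => [_|n /eqP /=]; first by rewrite expr0.
by rewrite eq_sym oner_eq0.
Qed.

Let genI (x y : K) : (x = y -> False) -> (x = - y -> False) -> gen x y.
Proof. by move=> H1 H2; split; apply/eqP. Qed.

Let genN (x y : K) : gen x y -> gen x (- y).
Proof. by move=> [? ?]; split; rewrite ?opprK. Qed.

(** If [g + h = 2 x], then [h - g = 2 (x - g)] is again twice a sum of two roots, [x] and [- g].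
    Here [x = - g] would give [3 g = - h], although [3] is not in [G]. *)
Let midpoint g h : G g -> G h -> gen g h -> (g + h) ^+ m = t ->
  exists x, [/\ G x, gen x g & (h - g) ^+ m = t * (x - g) ^+ m].
Proof.
move=> Gg Gh [/eqP gh _] E; exists ((g + h) / 2%:R); split.
- by rewrite expr_div_n E divff.
- apply: genI => E2.
    apply: gh; apply/eqP; rewrite eq_sym -subr_eq0; apply/eqP.
    by transitivity (2%:R * ((g + h) / 2%:R - g)); [field | rewrite E2; ring].
  apply: (G3 Gg (GN Gh)); apply/eqP; rewrite -subr_eq0; apply/eqP.
  by transitivity (2%:R * ((g + h) / 2%:R + g)); [field | rewrite E2; ring].
- by rewrite -exprMn; congr (_ ^+ m); field.
Qed.

(** One of [g + h], [h - g] and [x - g] works, for the midpoint [x]: if the first two are in [2 G],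
    then [(x - g) ^+ m = 1], which differs from [t]. *)
Lemma exists_sum_notin_2G (g h : K) :
    g ^+ m = 1 -> h ^+ m = 1 -> g != h -> g != - h ->
  exists x y : K,
    [/\ x ^+ m = 1, y ^+ m = 1, x + y != 0 & (x + y) ^+ m != 2%:R ^+ m].
Proof.
move=> Gg Gh gh gNh.
have [E|N] := eqVneq ((g + h) ^+ m) t; last first.
  by exists g, h; split; rewrite ?addr_eq0.
have [x [Gx [xg xNg] Ex]] := midpoint Gg Gh (conj gh gNh) E.
have [E2|N2] := eqVneq ((h - g) ^+ m) t; last first.
  by exists h, (- g); split=> //; [exact: GN | rewrite subr_eq0 eq_sym].
exists x, (- g); split=> //; first exact: GN.
  by rewrite subr_eq0.
move: Ex; rewrite E2 -[in LHS](mulr1 t) => /(mulfI t0) <-.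
by rewrite eq_sym.
Qed.

Hypothesis t2 : t ^+ 2 != 1.

(** * The case where all these sums lie in [2 G] or [4 G] *)

Section AllSums.

Hypothesis sumsP : forall g h, G g -> G h -> gen g h ->
  (g + h) ^+ m = t \/ (g + h) ^+ m = t ^+ 2.

(** With the midpoint [x], [(g - h) ^+ m = t * (x - g) ^+ m] is [t ^+ 2] or [t ^+ 3], and neither
    equals [t]. *)
Let diff_sum g h : G g -> G h -> gen g h -> (g + h) ^+ m = t ->
  (g - h) ^+ m = t ^+ 2.
Proof.
move=> Gg Gh gh E; have [x [Gx gx Ex]] := midpoint Gg Gh gh E.
have [|//] := sumsP Gg (GN Gh) (genN gh).
rewrite -expN opprB Ex; have [->|->] := sumsP Gx (GN Gg) (genN gx) => /mul_t E1.
  by move: t1; rewrite E1 eqxx.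
by move: t2; rewrite E1 eqxx.
Qed.

Let four_m : 4%:R ^+ m = t ^+ 2 :> K.
Proof. by rewrite (natrM _ 2 2) exprMn. Qed.

Let four : 4%:R != 0 :> K.
Proof. by rewrite (natrM _ 2 2) mulf_neq0. Qed.

(* If [x + y = 2 z], then [x - y = 4 w], and [x = z + 2 w], [y = z - 2 w] force
   both [z + w] and [z - w] into [2 G]. *)
Let no_sum_in_2G x y : G x -> G y -> gen x y -> (x + y) ^+ m = t -> False.
Proof.
move=> Gx Gy xy E; have E' := diff_sum Gx Gy xy E.
pose z := (x + y) / 2%:R; pose w := (x - y) / 4%:R.
have Gz : G z by rewrite expr_div_n E divff.
have Gw : G w by rewrite expr_div_n E' four_m divff ?expf_neq0.
have Ex : x = z + 2%:R * w by rewrite /z /w; field; rewrite four two.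
have Ey : y = z - 2%:R * w by rewrite /z /w; field; rewrite four two.
clearbody z w.
have zw : gen z w.
  apply: genI => zw.
    by apply: (G3 Gw Gx); rewrite Ex zw; ring.
  by apply: (G3 Gw (GN Gy)); rewrite Ey zw; ring.
have w0 : 2%:R * w != 0 by rewrite mulf_neq0 // G0.
have zwD0 : 2%:R * (z + w) != 0 by rewrite mulf_neq0 // addr_eq0 zw.2.
have zwB0 : 2%:R * (z - w) != 0 by rewrite mulf_neq0 // subr_eq0 zw.1.
have half_t u : (2%:R * u) ^+ m = t ^+ 2 -> u ^+ m = t.
  by rewrite exprMn => /(mulfI t0).
(* Since [x - z = 2 w] is in [2 G], [diff_sum] puts [x + z = 2 (z + w)] into [4 G]; likewise for [y]
   and [z - w]. *)
have zw1 : (z + w) ^+ m = t.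
  apply: half_t; rewrite (_ : 2%:R * _ = x - - z); last by rewrite Ex; ring.
  apply: diff_sum => //; first exact: GN.
    apply: genI => H.
      case/eqP: zwD0; rewrite (_ : 2%:R * _ = x + z); first by rewrite H addNr.
      by rewrite Ex; ring.
    case/eqP: w0; rewrite (_ : 2%:R * w = x - z); first by rewrite H opprK subrr.
    by rewrite Ex; ring.
  by rewrite Ex (_ : _ - z = 2%:R * w); [rewrite exprMn Gw mulr1 | ring].
have zw2 : (z - w) ^+ m = t.
  apply: half_t; rewrite (_ : 2%:R * _ = y - - z); last by rewrite Ey; ring.
  apply: diff_sum => //; first exact: GN.
    apply: genI => H.
      case/eqP: zwB0; rewrite (_ : 2%:R * _ = y + z); first by rewrite H addNr.
      by rewrite Ey; ring.
    case/eqP: w0; rewrite (_ : 2%:R * w = z - y); first by rewrite H opprK subrr.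
    by rewrite Ey; ring.
  rewrite Ey (_ : _ - z = 2%:R * - w); last by ring.
  by rewrite exprMn expN Gw mulr1.
have := diff_sum Gz Gw zw zw1; rewrite zw2 expr2 => /esym/mul_t E1.
by move: t1; rewrite E1 eqxx.
Qed.

(** All sums must lie in [4 G]. Then [(g + h) / 4] and [(g - h) / 4] are roots with sum [g / 2], so
    [t ^+ 2] is the inverse of [t], which leaves only characteristic 7. *)
Lemma sums_in_2G_4G_contradiction g h :
  G g -> G h -> gen g h -> t ^+ 3 != 1 \/ 7%:R = 0 :> K -> False.
Proof.
have all4 x y : G x -> G y -> gen x y -> (x + y) ^+ m = t ^+ 2.
  by move=> Gx Gy xy; have [/(no_sum_in_2G Gx Gy xy)|] := sumsP Gx Gy xy.
move=> Gg Gh gh.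
have t3 : t ^+ 3 = 1.
  pose x := (g + h) / 4%:R; pose y := (g - h) / 4%:R.
  have Gx : G x by rewrite expr_div_n all4 // four_m divff ?expf_neq0.
  have Gy : G y.
    by rewrite expr_div_n all4 ?four_m ?divff ?expf_neq0 //; [exact: GN | exact: genN].
  have xyE : x + y = g / 2%:R by rewrite /x /y; field; rewrite four two.
  have xy : gen x y.
    apply: genI => E.
      move/eqP: (mulf_neq0 two (G0 Gh)); apply; transitivity (4%:R * (x - y)).
        by rewrite /x /y; field.
      by rewrite E subrr mulr0.
    move/eqP: (mulf_neq0 two (G0 Gg)); apply; transitivity (4%:R * (x + y)).
      by rewrite /x /y; field.
    by rewrite E addNr mulr0.
  have := all4 x y Gx Gy xy; rewrite xyE expr_div_n Gg.
  by move=> E; rewrite exprS -E mul1r divff.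
case=> [/eqP//|seven].
(* As [t ^+ 3 = 1], doubling an element of [4 G] lands in [G]. Used twice, modulo 7, this makes
   [x + 3 y] a root; then [g + 3 h] and [g - 3 h] are roots whose sum [2 g] is in [2 G], not in
   [4 G]. *)
have double x y : G x -> G y -> gen x y -> G (2%:R * (x + y)).
  by move=> Gx Gy xy; rewrite exprMn (all4 x y) // -exprS.
have step x y : G x -> G y -> gen x y -> G (x + 3%:R * y).
  move=> Gx Gy xy.
  have Gz := double x y Gx Gy xy.
  have xz : gen x (2%:R * (x + y)).
    apply: genI => E.
      have {}E : 2%:R * y = - x.
        apply/eqP; rewrite -addr_eq0; apply/eqP.
        by transitivity (2%:R * (x + y) - x); [ring | rewrite -E subrr].
      by move/eqP: t1; apply; rewrite -[RHS](GN Gx) -E exprMn Gy mulr1.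
    apply: (G3 Gy (GN Gx)).
    have E0 : x + 2%:R * (x + y) = 0 by rewrite {1}E addNr.
    transitivity (5%:R * (x + 2%:R * (x + y)) - 7%:R * (2%:R * x + y) - x).
      by ring.
    by rewrite E0 seven mulr0 mul0r subrr add0r.
  have := double _ _ Gx Gz xz.
  rewrite (_ : 2%:R * _ = - (x + 3%:R * y) + 7%:R * (x + y)); last by ring.
  by rewrite seven mul0r addr0 => /GN; rewrite opprK.
have uv : gen (g + 3%:R * h) (g + 3%:R * - h).
  apply: genI => E.
    move/eqP: (G0 Gh); apply; transitivity (7%:R * h - (g + 3%:R * h - (g + 3%:R * - h))).
      by ring.
    by rewrite E subrr seven mul0r subr0.
  move/eqP: (mulf_neq0 two (G0 Gg)); apply.
  transitivity (g + 3%:R * h + (g + 3%:R * - h)); first by ring.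
  by rewrite E addNr.
have := all4 _ _ (step _ _ Gg Gh gh) (step _ _ Gg (GN Gh) (genN gh)) uv.
rewrite (_ : _ + _ = 2%:R * g); last by ring.
rewrite exprMn Gg mulr1 expr2 => /esym/mul_t E1.
by move: t1; rewrite E1 eqxx.
Qed.

End AllSums.
End SumsOfTwoRoots.

(** * Sums of [n] roots in a finite field *)

Definition root_sum (K : finFieldType) (m n : nat) (v : K) : bool :=
  [exists s : n.-tuple K, all (fun x => x ^+ m == 1) s && (\sum_(x <- s) x == v)].

Section RootSums.

Variables (K : finFieldType) (m : nat).

Lemma root_sumP n (v : K) :
  reflect (exists s : seq K,
             [/\ size s = n, all (fun x => x ^+ m == 1) s & \sum_(x <- s) x = v])
          (root_sum m n v).
Proof.
apply: (iffP existsP) => [[s /andP[As /eqP Es]]|[s [/eqP sn As Es]]].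
  by exists s; rewrite size_tuple.
by exists (Tuple sn); rewrite /= As Es eqxx.
Qed.

Lemma root_sumD n1 n2 (v w : K) :
  root_sum m n1 v -> root_sum m n2 w -> root_sum m (n1 + n2) (v + w).
Proof.
move=> /root_sumP[s [<- As <-]] /root_sumP[s' [<- As' <-]].
by apply/root_sumP; exists (s ++ s'); rewrite size_cat all_cat As As' big_cat.
Qed.

Lemma root_sum0 : root_sum m 0 (0 : K).
Proof. by apply/root_sumP; exists [::]; rewrite big_nil. Qed.

Lemma root_sum1 (x : K) : x ^+ m = 1 -> root_sum m 1 x.
Proof.
by move=> xm; apply/root_sumP; exists [:: x]; rewrite /= xm eqxx big_seq1.
Qed.

Lemma root_sum_char p : p \in [pchar K] -> root_sum m p (0 : K).
Proof.
move=> ch; apply/root_sumP; exists (nseq p 1); rewrite size_nseq; split=> //.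
  by rewrite all_nseq expr1n eqxx orbT.
by rewrite big_nseq iter_addr_0 (pcharf0 ch).
Qed.

Hypothesis m_even : ~~ odd m.

Lemma root_sumN n (v : K) : root_sum m n v -> root_sum m n (- v).
Proof.
move=> /root_sumP[s [<- As <-]]; apply/root_sumP; exists (map -%R s).
rewrite size_map big_map sumrN all_map; split=> //.
by apply: sub_all As => x /=; rewrite exprN_even.
Qed.

(** Pads with pairs [1], [-1], both roots because [m] is even. *)
Lemma root_sum_addr2 n k (v : K) : root_sum m n v -> root_sum m (n + k.*2) v.
Proof.
move=> Sv; elim: k => [|k IH]; first by rewrite addn0.
rewrite doubleS -addn2 addnA -[v]addr0; apply: root_sumD IH _.
rewrite -(subrr 1); apply: (@root_sumD 1 1).
  by apply: root_sum1; rewrite expr1n.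
by apply: root_sum1; rewrite exprN_even // expr1n.
Qed.

Lemma root_sum0_even n : ~~ odd n -> root_sum m n (0 : K).
Proof.
move=> n_even; rewrite -(even_halfK n_even) -[_.*2]add0n.
exact: root_sum_addr2 root_sum0.
Qed.

(* [0] is a sum of two roots, so only the parity of a length matters. *)
Lemma root_sum0_le n n0 : odd n0 -> (n0 <= n)%N ->
  root_sum m n0 (0 : K) -> root_sum m n (0 : K).
Proof.
move=> odd_n0 le_n S0; have [odd_n|] := boolP (odd n); last exact: root_sum0_even.
have even_d : ~~ odd (n - n0) by rewrite oddB // odd_n odd_n0.
by rewrite -(subnKC le_n) -(even_halfK even_d) root_sum_addr2.
Qed.

End RootSums.

(** * Sums of roots that lie in the prime field *)

Section PrimeFieldSums.

Variables (p m : nat) (K : finFieldType).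
Hypotheses (p_prime : prime p) (p_ge5 : (5 <= p)%N) (m_even : ~~ odd m).
Variable phi : {rmorphism 'F_p -> K}.
Hypothesis prime_field_roots : forall a, phi a ^+ m = 1 -> a = 1 \/ a = -1.
Hypothesis covering : forall v : K, v != 0 -> exists a g, g ^+ m = 1 /\ v = phi a * g.
Hypothesis m_gt2 : exists2 g : K, g ^+ m = 1 & (g != 1) && (g != -1).

Definition prime_sums n : {set 'F_p} := [set a | root_sum m n (phi a)].

Lemma Fp_natr_neq0 n : (0 < n < p)%N -> n%:R != 0 :> 'F_p.
Proof.
move=> /andP[n0 np]; rewrite -(dvdn_pcharf (pchar_Fp p_prime)).
by rewrite gtnNdvd.
Qed.

Lemma phi_natr_neq0 n : (0 < n < p)%N -> n%:R != 0 :> K.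
Proof. by move=> np; rewrite -(rmorph_nat phi) fmorph_eq0 Fp_natr_neq0. Qed.

(** Only [1] and [-1] of [F_p] are roots, and [2 <= n <= p - 2] avoids both. *)
Lemma natr_expm_neq1 n : (0 < n.-1)%N -> (n.+1 < p)%N -> n%:R ^+ m != 1 :> K.
Proof.
move=> n1 np; apply/eqP; rewrite -(rmorph_nat phi) => /prime_field_roots[] /eqP.
  have -> : n = (n.-1 + 1)%N by lia.
  by rewrite natrD addrC -subr_eq0 addrAC subrr add0r (negPf (Fp_natr_neq0 _)) //; lia.
by rewrite -addr_eq0 -mulrSr (negPf (Fp_natr_neq0 _)) //; lia.
Qed.

Lemma prime_sums0 n : ~~ odd n -> 0 \in prime_sums n.
Proof. by move=> n_even; rewrite inE rmorph0 root_sum0_even. Qed.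

Lemma prime_sumsN n : {in prime_sums n, forall a, - a \in prime_sums n}.
Proof. by move=> a; rewrite !inE rmorphN; apply: root_sumN. Qed.

Lemma prime_sumsD n1 n2 a b :
  a \in prime_sums n1 -> b \in prime_sums n2 -> a + b \in prime_sums (n1 + n2).
Proof. by rewrite !inE rmorphD; apply: root_sumD. Qed.

Lemma prime_sums1 : 1 \in prime_sums 1.
Proof. by rewrite inE rmorph1 root_sum1 ?expr1n. Qed.

Lemma prime_sums2_2 : 2%:R \in prime_sums 2.
Proof. by rewrite (natrD _ 1 1); apply: (@prime_sumsD 1 1); exact: prime_sums1. Qed.

Lemma card_prime_sumsD n1 n2 : ~~ odd n1 -> ~~ odd n2 ->
  (minn p (#|prime_sums n1| + #|prime_sums n2|).-1 <= #|prime_sums (n1 + n2)|)%N.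
Proof.
move=> e1 e2; apply: leq_trans (cauchy_davenport p_prime _ _) _.
- by apply/set0Pn; exists 0; apply: prime_sums0.
- by apply/set0Pn; exists 0; apply: prime_sums0.
- apply/subset_leq_card/subsetP=> _ /imset2P[a b Sa Sb ->].
  exact: prime_sumsD.
Qed.

(** By Cauchy-Davenport each further copy of [prime_sums 2] adds at least four elements, until [F_p]
    is full. *)
Lemma card_prime_sums_double r : (5 <= #|prime_sums 2|)%N ->
  (minn p (r.*2.*2.+1) <= #|prime_sums r.*2|)%N.
Proof.
move=> S2; elim: r => [|r IH].
  apply: leq_trans (geq_minr _ _) _; rewrite card_gt0; apply/set0Pn.
  by exists 0; apply: prime_sums0.
have := @card_prime_sumsD r.*2 2; rewrite odd_double => /(_ isT isT).
rewrite addn2 -doubleS; move: IH S2; rewrite -!muln2; lia.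
Qed.

(* If [1] is a sum of an even number of roots, subtracting the root [1] gives a
   vanishing sum of odd length. *)
Lemma root_sum0_prime_sums n :
  1 \in prime_sums n -> root_sum m n.+1 (0 : K).
Proof.
rewrite inE rmorph1 => S1; rewrite -addn1 -(subrr 1); apply: root_sumD => //.
by apply: root_sum1; rewrite exprN_even // expr1n.
Qed.

Lemma root_sum0_full n : (p <= #|prime_sums n|)%N -> root_sum m n.+1 (0 : K).
Proof.
move=> Sp; apply: root_sum0_prime_sums.
suff -> : prime_sums n = setT by rewrite inE.
by apply/eqP; rewrite eqEcard subsetT cardsT card_Fp.
Qed.

(** Write [x + y = phi a * g] by [covering] and divide by the root [g]: the summands stay roots and
    the coset of [G] stays the same. *)
Lemma prime_sums2_of_sum (x y : K) :
    x ^+ m = 1 -> y ^+ m = 1 -> x + y != 0 ->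
  exists a, [/\ a \in prime_sums 2, a != 0 & phi a ^+ m = (x + y) ^+ m].
Proof.
move=> Gx Gy xy; have [a [g [Gg E]]] := covering xy.
have g0 : g != 0.
  by apply: contraNneq xy => g0; rewrite E g0 mulr0.
exists a; split.
- rewrite inE; have -> : phi a = x / g + y / g by rewrite -mulrDl E mulfK.
  by apply: (@root_sumD _ _ 1 1); apply: root_sum1; rewrite expr_div_n ?Gx ?Gy Gg divr1.
- by apply: contraNneq xy => a0; rewrite E a0 rmorph0 mul0r.
- by rewrite E exprMn Gg mulr1.
Qed.

Lemma neq_of_expm (a b : 'F_p) : phi a ^+ m != phi b ^+ m -> (a != b) && (a != - b).
Proof.
move=> ab; apply/andP; split; apply: contraNneq ab => ->; rewrite ?rmorphN //.
by rewrite exprN_even.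
Qed.

Let two : 2%:R != 0 :> 'F_p. Proof. by apply: Fp_natr_neq0; lia. Qed.
Let twoK : 2%:R != 0 :> K. Proof. by apply: phi_natr_neq0; lia. Qed.
Let t1 : 2%:R ^+ m != 1 :> K. Proof. by apply: natr_expm_neq1; lia. Qed.
Let three_m : 3%:R ^+ m != 1 :> K. Proof. by apply: natr_expm_neq1; lia. Qed.

(** The five elements are [0], [2], [-2], [a] and [- a], with [a] obtained from a sum outside
    [2 G]. *)
Lemma card_prime_sums2 : (5 <= #|prime_sums 2|)%N.
Proof.
have [g Gg /andP[g1 gN1]] := m_gt2.
have [x [y [Gx Gy xy0 xyt]]] :=
  exists_sum_notin_2G m_even twoK three_m t1 Gg (expr1n _ _) g1 gN1.
have [a [Sa a0 Ea]] := prime_sums2_of_sum Gx Gy xy0.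
have /andP[a2 aN2] : (a != 2%:R) && (a != - 2%:R).
  by apply: neq_of_expm; rewrite Ea rmorph_nat.
apply: (@card_symmetric _ _ [:: a; 2%:R]) => /=.
- exact: two.
- exact: prime_sums0.
- exact: prime_sumsN.
- by apply/allP; rewrite /= Sa prime_sums2_2.
- by rewrite !inE !(eq_sym 0) (negPf a0) (negPf two).
- by rewrite a2 aN2.
Qed.

(** For [d = 2 r] the bound [4 r + 1] is exactly [p]. *)
Lemma root_sum0_even_index d : p = d.*2.+1 -> ~~ odd d -> root_sum m d.+1 (0 : K).
Proof.
move=> pE d_even; apply: root_sum0_full.
have := card_prime_sums_double d./2 card_prime_sums2.
by rewrite even_halfK // -pE minnn.
Qed.

Lemma exists_prime_sums2 : (7 <= p)%N -> exists a,
  [/\ a \in prime_sums 2, a != 0, a != 2%:R, a != - 2%:R & (a != 4%:R) && (a != - 4%:R)].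
Proof.
move=> p7; have [g Gg /andP[g1 gN1]] := m_gt2.
have E4 : 4%:R ^+ m = (2%:R ^+ m) ^+ 2 :> K by rewrite (natrM _ 2 2) exprMn.
have t2 : (2%:R ^+ m) ^+ 2 != 1 :> K by rewrite -E4 natr_expm_neq1 //; lia.
(* [2 ^ 3 = 8] is [1] or [-1] in [F_p] only if [p] divides [7] or [9]; with [p >= 7] this leaves
   [p = 7]. *)
have t3 : (2%:R ^+ m) ^+ 3 != 1 :> K \/ 7%:R = 0 :> K.
  have [p_eq7|p_neq7] := eqVneq p 7%N.
    right; rewrite -(rmorph_nat phi); apply/eqP; rewrite fmorph_eq0.
    by rewrite -(dvdn_pcharf (pchar_Fp p_prime)) p_eq7.
  left; rewrite exprAC -natrX; apply: natr_expm_neq1 => //.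
  have p8 : p != 8%N by apply: contraTneq p_prime => ->.
  have p9 : p != 9%N by apply: contraTneq p_prime => ->.
  by move: p7 p_neq7 p8 p9; clear; lia.
pose t : K := 2%:R ^+ m.
have [x [y [Gx Gy xy0 xyt]]] : exists x y : K, [/\ x ^+ m = 1, y ^+ m = 1,
    x + y != 0 & (x + y) ^+ m \notin [:: t; t ^+ 2]].
  have [/existsP[x /existsP[y /and4P[/eqP Gx /eqP Gy ? ?]]]|none] := boolP
    [exists x : K, exists y : K, [&& x ^+ m == 1, y ^+ m == 1,
       x + y != 0 & (x + y) ^+ m \notin [:: t; t ^+ 2]]]; first by exists x, y.
  exfalso; apply: (sums_in_2G_4G_contradiction m_even twoK three_m t1 t2
    _ Gg (expr1n _ m) _ t3) => //.
  move=> x y Gx Gy [_ xNy]; move: none.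
  move=> /existsPn/(_ x)/existsPn/(_ y).
  rewrite Gx Gy eqxx addr_eq0 xNy /= negbK !inE.
  by case/orP=> /eqP; [left|right].
have [a [Sa a0 Ea]] := prime_sums2_of_sum Gx Gy xy0.
move: xyt; rewrite !inE negb_or => /andP[xyt xyt2].
have /andP[a2 aN2] : (a != 2%:R) && (a != - 2%:R).
  by apply: neq_of_expm; rewrite Ea rmorph_nat.
exists a; split=> //.
by apply: neq_of_expm; rewrite Ea rmorph_nat E4.
Qed.

(** With [0], the five classes of [pairwise_five] give eleven elements. If [a] is one of the
    exceptions [- 6] and [- 2 / 3] there, then [- a] is not, because [4], [12] and [20] are
    nonzero. *)
Lemma card_prime_sums4 a :
    (11 <= p)%N -> a \in prime_sums 2 ->
    [&& a != 0, a != 1, a != -1, a != 2%:R, a != - 2%:R, a != 4%:R & a != - 4%:R] ->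
  (11 <= #|prime_sums 4|)%N.
Proof.
move=> p11; have three : 3%:R != 0 :> 'F_p by apply: Fp_natr_neq0; lia.
have four : 4%:R != 0 :> 'F_p by apply: Fp_natr_neq0; lia.
have twelve : 12%:R != 0 :> 'F_p by rewrite (natrM _ 3 4) mulf_neq0.
have twenty : 20%:R != 0 :> 'F_p.
  have five : 5%:R != 0 :> 'F_p by apply: Fp_natr_neq0; clear -p11; lia.
  by rewrite (natrM _ 4 5) mulf_neq0.
have S2 := prime_sums2_2; have S20 := @prime_sums0 2 isT.
have main b : b \in prime_sums 2 ->
    [&& b != 0, b != 1, b != -1, b != 2%:R, b != - 2%:R, b != 4%:R & b != - 4%:R] ->
    b != - 6%:R -> 3%:R * b != - 2%:R -> (11 <= #|prime_sums 4|)%N.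
  move=> Sb Hb b6 b3; have /andP[s0 ps] := pairwise_five two three Hb b6 b3.
  apply: card_symmetric two _ _ _ s0 ps; [exact: prime_sums0|exact: prime_sumsN|].
  have D u v : u \in prime_sums 2 -> v \in prime_sums 2 -> u + v \in prime_sums 4.
    exact: (@prime_sumsD 2 2).
  apply/allP; rewrite /= andbT; apply/and5P; split.
  - by rewrite -[2%:R]addr0 D.
  - by rewrite (natrD _ 2 2) D.
  - by rewrite -[b]addr0 D.
  - by rewrite mulr_natl mulr2n D.
  - by rewrite D.
move=> Sa Ha.
have HN : [&& - a != 0, - a != 1, - a != -1, - a != 2%:R, - a != - 2%:R,
              - a != 4%:R & - a != - 4%:R].
  move: Ha; rewrite oppr_eq0 !(eqr_oppLR a) !opprK.
  by move=> /and5P[-> -> -> -> /and3P[-> -> ->]].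
have [a6|a6] := eqVneq a (- 6%:R); last first.
  have [a3|a3] := eqVneq (3%:R * a) (- 2%:R); last exact: main a6 a3.
  apply: (main (- a)) => //; first exact: prime_sumsN.
    rewrite eqr_opp; apply/eqP=> E; case/eqP: twenty.
    by transitivity (3%:R * a + 2%:R); [rewrite E; ring | rewrite a3 addNr].
  apply/eqP=> E; case/eqP: four.
  by transitivity (3%:R * - a + 3%:R * a + 4%:R); [ring | rewrite E a3; ring].
apply: (main (- a)) => //; first exact: prime_sumsN.
  rewrite a6 opprK; apply/eqP=> E; case/eqP: twelve.
  by transitivity (6%:R + 6%:R : 'F_p); [ring | rewrite {1}E addNr].
rewrite a6 opprK; apply/eqP=> E; case/eqP: twenty.
by transitivity (3%:R * 6%:R + 2%:R : 'F_p); [ring | rewrite E addNr].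
Qed.

Lemma root_sum0_odd_index d : p = d.*2.+1 -> odd d -> root_sum m d (0 : K).
Proof.
move=> pE d_odd.
(* Here [d >= 3], since [d = 1] would give [p = 3]. *)
have [r [dE pr]] : exists r, d = r.*2.+3 /\ p = (r.*2.*2 + 7)%N.
  case: d d_odd pE => [|[|[|d]]] //= d_odd pE; first by move: p_ge5; rewrite pE.
  rewrite negbK in d_odd.
  by exists d./2; rewrite even_halfK // pE addnC !doubleS.
have p7 : (7 <= p)%N by rewrite pr leq_addl.
have [a [Sa a0 a2 aN2 /andP[a4 aN4]]] := exists_prime_sums2 p7.
(* If [a] is [1] or [-1], then [1] is in [prime_sums 2]; padding puts it into
   [prime_sums (2 r + 2)], and [d = 2 r + 3]. *)
have [a1|/norP[a1 aN1]] := boolP ((a == 1) || (a == -1)).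
  have S1 : 1 \in prime_sums 2.
    by case/orP: a1 Sa => /eqP-> // /prime_sumsN; rewrite opprK.
  rewrite dE; apply: root_sum0_prime_sums; move: S1; rewrite !inE => S1.
  by rewrite -addn2 addnC; apply: root_sum_addr2.
case: r dE pr => [|r] dE pr.
  have {}pr : p = 7%N := pr.
  have seven : 7%:R = 0 :> 'F_p by rewrite -pr (pcharf0 (pchar_Fp p_prime)).
  have a7 : a ^+ 7 = a by rewrite -pr -[p in _ ^+ p](card_Fp p_prime) expf_card.
  (* All seven elements of [F_7] are excluded: the product below is [a ^+ 7 - a]. *)
  have : a * (a - 1) * (a + 1) * (a - 2%:R) * (a + 2%:R) * (a - 4%:R) * (a + 4%:R) = 0.
    transitivity (a ^+ 7 - a + 7%:R * (12%:R * a ^+ 3 - 3%:R * a ^+ 5 - 9%:R * a)).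
      by ring.
    by rewrite a7 seven subrr mul0r addr0.
  move/eqP; rewrite !mulf_eq0 !subr_eq0 !addr_eq0.
  by rewrite (negPf a0) (negPf a1) (negPf aN1) (negPf a2) (negPf aN2) (negPf a4)
    (negPf aN4).
have p11 : (11 <= p)%N by rewrite pr !doubleS !addSn !ltnS addnC.
have S4 : (11 <= #|prime_sums 4|)%N.
  by apply: (@card_prime_sums4 a); rewrite // a0 a1 aN1 a2 aN2 a4 aN4.
(* Now [d - 1 = 2 r + 4] and [p = 4 r + 11]: the bounds [4 r + 1] and [11] add up to [p + 1], just
   enough for [prime_sums (d - 1)] to be full. *)
have := @card_prime_sumsD r.*2 4; rewrite odd_double => /(_ isT isT).
have := card_prime_sums_double r card_prime_sums2.
rewrite dE => S2 Sd; apply: root_sum0_full; move: Sd S2.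
rewrite (_ : (r.+1).*2.+2 = (r.*2 + 4)%N); last by rewrite addnC.
by clear -pr S4; lia.
Qed.

End PrimeFieldSums.

(** * Transport along field embeddings *)

Lemma root_sum_vanishing (L : closedFieldType) (K : finFieldType)
    (j : {rmorphism K -> L}) (m n : nat) :
  root_sum m n (0 : K) -> vanishing_length L m n.
Proof.
move=> /existsP[s /andP[As /eqP Es]]; exists (fun i => j (tnth s i)); split.
  move=> i; rewrite -rmorphXn; have /allP/(_ _ (mem_tnth i s))/eqP-> := As.
  exact: rmorph1.
by rewrite -rmorph_sum -(big_tuple _ _ s predT (fun x => x)) Es rmorph0.
Qed.

(** The inclusion of the prime field, read off from the [F_p]-algebra structure of [K] in
    characteristic [p]. *)
Definition prime_field_embedding (p : nat) (K : finFieldType) (ch : p \in [pchar K]) :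
    {rmorphism 'F_p -> K} :=
  (in_alg (pPrimeCharType ch) : {rmorphism 'F_p -> pPrimeCharType ch}).

(** * The subgroup [F_p^* G] and the index of [G] *)

Section Index.

Variables (p m d : nat) (K : finFieldType) (phi : {rmorphism 'F_p -> K}).
Hypotheses (p_prime : prime p) (m_gt0 : (0 < m)%N) (gcd_pm : gcdn (p - 1) m = 2%N).

(** The order of [a] divides both [p - 1] and [m], hence [2]. *)
Lemma prime_field_roots_of_unity (a : 'F_p) : phi a ^+ m = 1 -> a = 1 \/ a = -1.
Proof.
rewrite -rmorphXn => /eqP; rewrite fmorph_eq1 => /eqP am.
have a_unit : a \is a GRing.unit.
  rewrite unitfE; apply: contra_eq_neq am => ->.
  by rewrite expr0n gtn_eqF // eq_sym oner_eq0.
pose u : {unit 'F_p} := FinRing.unit _ a_unit.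
have um : (u ^+ m = 1)%g by apply: val_inj; rewrite FinRing.val_unitX.
have up : (#[u]%g %| p - 1)%N.
  by rewrite subn1 -[p in p.-1](card_Fp p_prime) -card_finField_unit order_dvdG ?inE.
have : (#[u]%g %| 2)%N by rewrite -gcd_pm dvdn_gcd up order_dvdn um eqxx.
rewrite order_dvdn => /eqP/(congr1 val); rewrite FinRing.val_unitX /= => /eqP.
by rewrite sqrf_eq1 => /orP[]/eqP; [left|right].
Qed.

Lemma card_pm1_le2 (A : {set {unit K}}) :
  {in A, forall u, val u = 1 \/ val u = -1} -> (#|A| <= 2)%N.
Proof.
move=> A1; rewrite -(card_imset _ val_inj).
apply: leq_trans (subset_leq_card (_ : _ \subset [set 1; -1])) _.
  apply/subsetP=> _ /imsetP[u /A1 Au ->]; rewrite !inE.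
  by case: Au => ->; rewrite eqxx ?orbT.
by rewrite cards2; case: (_ != _).
Qed.

Let f (u : {unit 'F_p}) : {unit K} := FinRing.unit K (rmorph_unit phi (valP u)).

Let fM : {in [set: {unit 'F_p}] &, {morph f : u v / (u * v)%g}}.
Proof. by move=> u v _ _; apply: val_inj; rewrite /= rmorphM. Qed.

Let fm := Morphism fM.

Hypothesis cardG : (d * #|roots_of_unity K m| = #|K|.-1)%N.

(** Let [H] be the image of [F_p^*] and [c] the index of [H G]. Then [d * #|H :&: G| = c * (p - 1)]
    with [#|H :&: G| <= 2], so [d < p - 1] forces [#|H :&: G| = 2] and [c = 1], that is
    [H G = K^*]. *)
Lemma index_dichotomy : (p - 1 <= d)%N \/
  (p = d.*2.+1 /\
   forall v : K, v != 0 -> exists a g, g ^+ m = 1 /\ v = phi a * g).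
Proof.
have f_inj : ('injm fm)%g.
  apply/injmP=> u v _ _ /(congr1 val)/= /fmorph_inj uv; exact: val_inj.
pose H := (fm @* [set: {unit 'F_p}])%G.
pose G := roots_of_unity_group K m.
have cardH : #|H| = (p - 1)%N.
  by rewrite card_injm // card_finField_unit card_Fp // subn1.
have abelK : abelian [set: {unit K}].
  by apply/centsP=> u _ v _; apply: val_inj; rewrite /= mulrC.
have HI2 : (#|H :&: G| <= 2)%N.
  apply: card_pm1_le2 => u /setIP[/morphimP[a _ _ ->]]; rewrite inE => /eqP/(congr1 val).
  rewrite FinRing.val_unitX /= => /prime_field_roots_of_unity[]->;
    rewrite ?rmorphN rmorph1; by [left|right].
have HGE : (H <*> G = H * G)%g.
  apply: norm_joinEr.
  exact: subset_trans (subsetT _) (sub_abelian_norm abelK (subsetT _)).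
have HGdvd : (#|(H * G)%g| %| #|K|.-1)%N.
  by rewrite -HGE -card_finField_unit cardSg // subsetT.
have := mul_cardG H G; rewrite cardH.
have G0 : (0 < #|G|)%N := cardG_gt0 G.
have I0 : (0 < #|H :&: G|)%N := cardG_gt0 _.
have K1 : (0 < #|K|.-1)%N by rewrite -card_finField_unit cardG_gt0.
case/dvdnP: HGdvd => c cE; move: cardG K1; rewrite -/G cE => dG cHG0 pG.
have [|d_lt] := leqP (p - 1) d; [by left | right].
have I2 : #|(H :&: G)%g| = 2%N.
  apply/eqP; rewrite eqn_leq HI2 ltn_neqAle I0 andbT; apply: contraTneq d_lt => I1.
  rewrite -leqNgt -(leq_pmul2r G0) dG pG -I1 muln1 leq_pmull //.
  by case: c cHG0 {cE dG}.
have c1 : c = 1%N.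
  apply/eqP; rewrite eqn_leq andbC lt0n; apply/andP; split.
    by apply: contraTneq cHG0 => ->.
  rewrite leqNgt; apply: contraTN d_lt => c2.
  rewrite -leqNgt -(leq_pmul2r G0) dG pG I2 mulnC leq_mul2r c2 orbT //.
rewrite c1 mul1n in cE dG.
split.
  have : (d.*2 * #|G| = (p - 1) * #|G|)%N by rewrite pG I2 -dG -muln2 mulnAC.
  move/eqP; rewrite eqn_pmul2r // => /eqP->; rewrite subn1 prednK //.
  exact: prime_gt0.
have HGT : (H * G)%g = [set: {unit K}].
  by apply/eqP; rewrite eqEcard subsetT card_finField_unit cE leqnn.
move=> v v0; have v_unit : v \is a GRing.unit by rewrite unitfE.
have := in_setT (FinRing.unit K v_unit); rewrite -HGT.
case/mulsgP=> _ g /morphimP[a _ _ ->]; rewrite inE.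
move=> /eqP/(congr1 val) Gg /(congr1 val) /= ->.
by exists (val a), (val g); rewrite -FinRing.val_unitX Gg.
Qed.

End Index.
Local Close Scope ring_scope.

(** * All lengths from [d] on, and the exceptional case [p = 3] *)

Theorem theorem4p1
  (p m k d : nat) (p_prime : prime p) (m_ge3 : 3 <= m)
  (gcd_pm : gcdn (p - 1) m = 2)
  (* L is an algebraic closure of F_p *)
  (L : closedFieldType) (iota : {rmorphism 'F_p -> L})
  (L_algebraic : integralRange iota)
  (* K is a subfield of L, through j, that contains every m-th root of unity *)
  (K : finFieldType) (j : {rmorphism K -> L}) (cardK : #|K| = p ^ k)
  (K_roots : forall x : L, (x ^+ m = 1)%R -> exists y : K, j y = x)
  (* d = [K^* : G] = (p ^ k - 1) / m, the latter as an exact quotient *)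
  (d_index : d = #|[set: {unit K}] : roots_of_unity K m|%g)
  (d_quotient : d * m = p ^ k - 1) :
  (~ (p = 3 /\ m = 3 ^ k - 1) ->
     forall n : nat, d <= n -> vanishing_length L m n) /\
  (p = 3 /\ m = 3 ^ k - 1 ->
     forall n : nat, d + 1 <= n -> vanishing_length L m n).
Proof.
have m_even : ~~ odd m by rewrite -dvdn2 -gcd_pm dvdn_gcdr.
have p_odd : odd p.
  have : 2 %| p - 1 by rewrite -gcd_pm dvdn_gcdl.
  by rewrite dvdn2 oddB ?prime_gt0 // addbT negbK.
have m_gt0 : 0 < m by apply: leq_trans m_ge3.
have pK : p \in [pchar K]%R by apply: (card_finPcharP cardK).
have cardU : #|[set: {unit K}]| = p ^ k - 1.
  by rewrite card_finField_unit cardK subn1.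
have cardG : d * #|roots_of_unity K m| = #|K|.-1.
  by rewrite mulnC d_index Lagrange ?subsetT // card_finField_unit.
have d_gt0 : 0 < d by rewrite d_index indexg_gt0.
have G_card : #|roots_of_unity K m| = m.
  apply/eqP; rewrite -(eqn_pmul2l d_gt0) cardG d_quotient cardK subn1 //.
have even_case n : ~~ odd n -> vanishing_length L m n.
  by move=> n_even; apply: (root_sum_vanishing j); apply: root_sum0_even.
have odd_case n0 n : odd n0 -> n0 <= n -> root_sum m n0 (0%R : K) ->
    vanishing_length L m n.
  move=> o le S; apply: (root_sum_vanishing j).
  exact: (root_sum0_le m_even o le S).
have large n : p <= n -> vanishing_length L m n.
  by move=> pn; apply: odd_case p_odd pn (root_sum_char _ pK).
split; last first.
  (* Here [d = 1], and an odd [n >= 2] is at least [p = 3]. *)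
  move=> [p3 mE] n dn; have d1 : d = 1.
    by apply/eqP; rewrite -(eqn_pmul2r m_gt0) d_quotient mul1n p3 -mE.
  rewrite d1 addn1 in dn; have [|n_odd] := boolP (~~ odd n); first exact: even_case.
  apply: large; rewrite p3; case: n dn n_odd => [|[|[|n]]] //.
move=> not_exc n dn.
have [n_odd|/even_case //] := boolP (odd n).
pose phi := prime_field_embedding pK.
have [d_large|[pE cover]] := index_dichotomy phi p_prime m_gt0 gcd_pm cardG.
  (* An odd [n >= p - 1] is at least [p], since [p - 1] is even. *)
  apply: large; have := leq_trans d_large dn; rewrite leq_subLR add1n.
  by rewrite leq_eqVlt => /orP[/eqP pn|//]; rewrite pn /= n_odd in p_odd.
have p_ge5 : 5 <= p.
  rewrite pE ltnS (leq_double 2) ltn_neqAle d_gt0 andbT.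
  (* [d = 1] would give [p = 3] and [m = 3 ^ k - 1], the excluded case. *)
  apply/eqP=> d1; apply: not_exc; split; first by rewrite pE -d1.
  by move: d_quotient; rewrite pE -d1 mul1n.
have roots := prime_field_roots_of_unity (phi := phi) p_prime m_gt0 gcd_pm.
(* [G] has [m >= 3] elements, so one of them is neither [1] nor [-1]. *)
have m_gt2 : exists2 g : K, (g ^+ m = 1)%R & ((g != 1) && (g != -1))%R.
  have [/exists_inP[u Gu nu]|/exists_inPn none] := boolP
      [exists u in roots_of_unity K m, (val u != 1) && (val u != -1)]%R.
    exists (val u) => //; move: Gu; rewrite inE => /eqP/(congr1 val).
    by rewrite FinRing.val_unitX.
  suff : m <= 2 by rewrite leqNgt m_ge3.
  rewrite -G_card; apply: card_pm1_le2 => u /none.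
  by rewrite negb_and !negbK => /orP[]/eqP; [left|right].
have [d_odd|d_even] := boolP (odd d).
  apply: (odd_case d n d_odd dn).
  exact: (root_sum0_odd_index p_prime p_ge5 m_even roots cover m_gt2 pE d_odd).
(* For even [d] and odd [n], [n >= d] means [n >= d + 1]. *)
apply: (odd_case d.+1) => //.
  rewrite ltn_neqAle dn andbT; apply: contraNneq d_even => ->; exact: n_odd.
exact: (root_sum0_even_index p_prime p_ge5 m_even roots cover m_gt2 pE d_even).
Qed.
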